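(* Let $p$ be a prime, let $S$ be a standard semigroup in $\mathbb{Z}^d$, let $T_\bullet=\{T_q\}_q$ be a $p$-system of ideals in $S$ (indexed by the powers $q=p^e$, $e\ge 0$), and let $H$ be any truncating halfspace for $\operatorname{Cone}(S)$. Then for every $\epsilon>0$ there exists $q_0$ such that for every power $q$ of $p$ with $q\ge q_0$, $$\lim_{e\to\infty}\frac{\#\big((p^eT_q+S)\cap p^e qH\big)}{p^{ed}q^d}\;\ge\;\operatorname{Vol}_{\mathbb{R}^d}\big(\Delta(S,T_\bullet)\cap H\big)-\epsilon .$$
   Context: Sums of subsets of $\mathbb{R}^d$ are Minkowski sums: $U+V=\{u+v: u\in U, v\in V\}$; $S-S=\{s-s' : s,s'\in S\}$; for a scalar $\lambda$, $\lambda U=\{\lambda u:u\in U\}$. $\operatorname{Vol}_{\mathbb{R}^d}$ is Lebesgue measure and $(-,-)$ is the standard inner product on $\mathbb{R}^d$. For $U\subseteq\mathbb{R}^d$, $\operatorname{Cone}(U)$ is the closure of the set of all finite linear combinations $\sum_i\lambda_iu_i$ with $u_i\in U$, $\lambda_i\in\mathbb{R}_{\ge0}$. A convex cone $C$ is pointed if it is closed and there is a vector $\boldsymbol{a}\in\mathbb{R}^d$ with $(\boldsymbol{u},\boldsymbol{a})>0$ for all $\boldsymbol{u}\in C\setminus\{\boldsymbol{0}\}$. For such an $\boldsymbol{a}$ and a non-negative real number $\alpha$, the set $H=\{\boldsymbol{u}\in\mathbb{R}^d : (\boldsymbol{u},\boldsymbol{a})<\alpha\}$ is called a truncating halfspace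 for $C$. A semigroup (in $\mathbb{Z}^d$) is a subset of $\mathbb{Z}^d$ containing $\boldsymbol{0}$ and closed under addition. A subset $T\subseteq S$ is an ideal of the semigroup $S$ if $S+T\subseteq T$. A semigroup $S\subseteq \mathbb{Z}^d$ is standard if $S-S=\mathbb{Z}^d$ and the (full-dimensional) cone $\operatorname{Cone}(S)\subseteq\mathbb{R}^d$ is pointed. A $p$-system of ideals in $S$ is a collection $T_\bullet=\{T_q\}$ of subsets of $S$ indexed by $q=p^e$, $e\ge0$, such that each $T_q$ is an ideal of $S$ and $pT_q\subseteq T_{pq}$ for all $q$. The $p$-body associated to $T_\bullet$ is $\Delta(S,T_\bullet)=\bigcup_{q}\Delta_q(S,T_\bullet)$, the union over all powers $q$ of $p$, where $\Delta_q(S,T_\bullet)=\frac1qT_q+\operatorname{Cone}(S)$. *)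

(* Defs.v *)
From HB Require Import structures.
From mathcomp Require Import all_boot all_order all_algebra.
From mathcomp Require Import all_classical all_reals all_analysis.

Set Implicit Arguments.
Unset Strict Implicit.
Unset Printing Implicit Defensive.

Import Order.TTheory GRing.Theory Num.Theory.
Import numFieldNormedType.Exports.

Local Open Scope classical_set_scope.
Local Open Scope ring_scope.

Definition minkowski_add (V : zmodType) (A B : set V) : set V :=
  [set u + v | u in A & v in B].

Definition minkowski_sub (V : zmodType) (A B : set V) : set V :=
  [set u - v | u in A & v in B].

Definition scale_set (K : pzRingType) (V : lmodType K) (a : K) (A : set V) :
    set V :=
  [set a *: u | u in A].

Section Lebesgue.
Context {R : realType} {d : nat}.
Implicit Types A : set 'rV[R]_d.

Definition box (a b : 'rV[R]_d) : set 'rV[R]_d :=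
  [set x | forall i, a 0 i <= x 0 i <= b 0 i].

(* The volume of [box a b], provided that [a] is below [b] coordinatewise. *)
Definition box_volume (a b : 'rV[R]_d) : R := \prod_(i < d) (b 0 i - a 0 i).

(* The cover is indexed by a subset [D] of [nat], so that it may be finite or
   empty: for [d = 0] every box has volume 1. *)
Definition box_cover A (D : set nat) (a b : nat -> 'rV[R]_d) : Prop :=
  (forall k i, a k 0 i <= b k 0 i) /\ A `<=` \bigcup_(k in D) box (a k) (b k).

Definition lebesgue_outer A : \bar R :=
  ereal_inf [set x | exists D (a b : nat -> 'rV[R]_d), box_cover A D a b /\
                       x = (\esum_(k in D) (box_volume (a k) (b k))%:E)%E].

Lemma box_volume_ge0 (a b : 'rV[R]_d) :
  (forall i, a 0 i <= b 0 i) -> 0 <= box_volume a b.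
Proof. by move=> ab; apply: prodr_ge0 => i _; rewrite subr_ge0. Qed.

Lemma lebesgue_outer_ge0 A : (0 <= lebesgue_outer A)%E.
Proof.
apply: le_ereal_inf_tmp => _ [D [a [b [[ab _] ->]]]].
by apply: esum_ge0 => k _; rewrite lee_fin box_volume_ge0.
Qed.

Lemma lebesgue_outer0 : lebesgue_outer set0 = 0%E.
Proof.
apply/eqP; rewrite eq_le lebesgue_outer_ge0 andbT.
apply: ereal_inf_lbound; exists set0, (fun=> 0), (fun=> 0).
by split; [split|rewrite esum_set0].
Qed.

Lemma le_lebesgue_outer :
  {homo lebesgue_outer : A B / A `<=` B >-> (A <= B)%E}.
Proof.
move=> A B AB; apply: ereal_inf_le_tmp => x [D [a [b [[ab BD] ->]]]].
by exists D, a, b; split=> //; split=> //; exact: subset_trans BD.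
Qed.

Lemma lebesgue_outer_sigma_subadditive : sigma_subadditive lebesgue_outer.
Proof.
move=> A; have [[i ioo]|] := pselect (exists i, lebesgue_outer (A i) = +oo%E).
  rewrite (eseries_pinfty _ _ ioo) ?leey// => n _.
  by rewrite -ltNye (lt_le_trans _ (lebesgue_outer_ge0 _)).
rewrite -forallNE => Aoo.
apply/lee_addgt0Pr => _/posnumP[e].
apply: (le_trans _ (epsilon_trick xpredT
  (fun n => lebesgue_outer_ge0 (A n)) (ge0 e))).
pose P n (c : set nat * ((nat -> 'rV[R]_d) * (nat -> 'rV[R]_d))) :=
  box_cover (A n) c.1 c.2.1 c.2.2 /\
  (\esum_(k in c.1) (box_volume (c.2.1 k) (c.2.2 k))%:E <=
    lebesgue_outer (A n) + (e%:num / (2 ^ n.+1)%:R)%:E)%E.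
have [c Pc] : {c & forall n, P n (c n)}.
  apply: (@choice _ _ P) => n.
  have en0 : 0 < e%:num / (2 ^ n.+1)%:R :> R by rewrite divr_gt0// ltr0n expn_gt0.
  have fA : lebesgue_outer (A n) \is a fin_num.
    rewrite ge0_fin_numE ?lebesgue_outer_ge0//.
    by rewrite ltey; apply/eqP/Aoo.
  have [_ [D [a [b [cov ->]]]] lt] := lb_ereal_inf_adherent en0 fA.
  by exists (D, (a, b)); split=> //; exact/ltW.
have vol_ge0 n k : (0 <= (box_volume ((c n).2.1 k) ((c n).2.2 k))%:E)%E.
  by rewrite lee_fin box_volume_ge0//; case: (Pc n) => -[].
have /card_esym/ppcard_eqP[f] := card_nat2.
pose E : set nat := [set k | (c (f k).1).1 (f k).2].
apply: (@le_trans _ _ (\esum_(k in E)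
    (box_volume ((c (f k).1).2.1 (f k).2) ((c (f k).1).2.2 (f k).2))%:E)%E).
  apply: ereal_inf_lbound.
  exists E, (fun k => (c (f k).1).2.1 (f k).2),
            (fun k => (c (f k).1).2.2 (f k).2); split=> //; split=> [k i|].
    by case: (Pc (f k).1) => -[].
  move=> x [n _ Anx]; have [[_ /(_ x Anx)[k Dk xk]] _] := Pc n.
  by exists (f^-1%FUN (n, k)) => /=; rewrite /E/= invK ?inE.
have bijE : set_bij E (setT `*`` (fun n => (c n).1)) f.
  split.
  - by move=> k /=; split.
  - by move=> x y _ _; apply: inj; rewrite inE.
  - move=> [n k] /= [_ nk]; exists (f^-1%FUN (n, k)); rewrite /E/= invK ?inE//.
rewrite -(reindex_esum _ _ _ (fun nk => (box_volume ((c nk.1).2.1 nk.2)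
  ((c nk.1).2.2 nk.2))%:E) bijE).
rewrite -(@esum_esum _ _ _ setT (fun n => (c n).1) (fun n k =>
  (box_volume ((c n).2.1 k) ((c n).2.2 k))%:E))//.
rewrite nneseries_esumT; last first.
  by move=> n; rewrite adde_ge0// ?lebesgue_outer_ge0.
by apply: le_esum => n _; case: (Pc n).
Qed.

HB.instance Definition _ := isOuterMeasure.Build R 'rV[R]_d lebesgue_outer
  lebesgue_outer0 lebesgue_outer_ge0 le_lebesgue_outer
  lebesgue_outer_sigma_subadditive.

Definition lebesgue_outer_measure :
    {outer_measure set 'rV[R]_d -> \bar R} :=
  lebesgue_outer.

(* Lebesgue measure is the restriction of the outer measure to its
   Caratheodory-measurable sets. *)
Definition Vol :
    {measure set (caratheodory_type lebesgue_outer_measure) -> \bar R} :=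
  lebesgue_outer_measure :
    set (caratheodory_type lebesgue_outer_measure) -> \bar R.

End Lebesgue.

Section Cones.
Context {R : realType} {d : nat}.
Implicit Types (v w a : 'rV[R]_d) (U C H : set 'rV[R]_d).

Definition inner v w : R := \sum_(i < d) v 0 i * w 0 i.

Definition conic_hull U : set 'rV[R]_d :=
  [set x | exists n (lambda : 'I_n -> R) (u : 'I_n -> 'rV[R]_d),
     [/\ forall i, 0 <= lambda i, forall i, U (u i) &
         x = \sum_(i < n) lambda i *: u i]].

Definition Cone U : set 'rV[R]_d := closure (conic_hull U).

Definition positive_on C a : Prop := forall v, C v -> v <> 0 -> 0 < inner v a.

Definition convex_cone C : Prop :=
  [/\ C 0, forall v w, C v -> C w -> C (v + w) &
      forall (t : R) v, 0 <= t -> C v -> C (t *: v)].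

Definition pointed C : Prop :=
  [/\ convex_cone C, closed C & exists a, positive_on C a].

Definition truncating_halfspace C H : Prop :=
  exists a (alpha : R),
    [/\ positive_on C a, 0 <= alpha & H = [set v | inner v a < alpha]].

End Cones.

Definition lattice_embed (R : realType) {d : nat} (z : 'rV[int]_d) : 'rV[R]_d :=
  map_mx intr z.

Definition semigroup d (S : set 'rV[int]_d) : Prop :=
  S 0 /\ minkowski_add S S `<=` S.

Definition ideal d (S T : set 'rV[int]_d) : Prop :=
  T `<=` S /\ minkowski_add S T `<=` T.

Definition coneS (R : realType) d (S : set 'rV[int]_d) : set 'rV[R]_d :=
  Cone (lattice_embed R @` S).
Arguments coneS R {d} S.

Definition standard (R : realType) d (S : set 'rV[int]_d) : Prop :=
  [/\ semigroup S, minkowski_sub S S = setT & pointed (coneS R S)].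

Definition power_of (p q : nat) : Prop := exists e, q = (p ^ e)%N.

(* The family is indexed by all naturals, but only its values at the powers
   of [p] are ever constrained or used. *)
Definition p_system (p : nat) d (S : set 'rV[int]_d)
    (T : nat -> set 'rV[int]_d) : Prop :=
  forall q, power_of p q ->
    ideal S (T q) /\ scale_set p%:Z (T q) `<=` T (p * q)%N.

Definition Delta_q (R : realType) d (S : set 'rV[int]_d)
    (T : nat -> set 'rV[int]_d) (q : nat) : set 'rV[R]_d :=
  minkowski_add (scale_set q%:R^-1 (lattice_embed R @` T q)) (coneS R S).
Arguments Delta_q R {d} S T q.

Definition p_body (R : realType) (p : nat) d (S : set 'rV[int]_d)
    (T : nat -> set 'rV[int]_d) : set 'rV[R]_d :=
  \bigcup_(q in power_of p) Delta_q R S T q.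
Arguments p_body R p {d} S T.

(* The lattice points of (p^e T_q + S) lying in p^e q H, as a subset of Z^d. *)
Definition truncated_points (R : realType) (p : nat) d (S : set 'rV[int]_d)
    (T : nat -> set 'rV[int]_d) (H : set 'rV[R]_d) (q e : nat) :
    set 'rV[int]_d :=
  minkowski_add (scale_set (p ^ e)%N%:Z (T q)) S `&`
  lattice_embed R @^-1` scale_set (p ^ e * q)%:R H.

(* Main.v *)
(* Everything rests on one counting estimate. Let C = Cone(S), let N = p^e q and
   let M be a power of p. If F is a finite set of lattice points z such that z/M
   is within 1/M of Delta_q and z/M stays O(1/M) inside H, then for a fixed
   lattice vector W deep in C, and k = N/M, each of the k^d points k(z + W) + v,
   0 <= v_i < k, lies in p^e T_q + S and in N H once e is large. Hence the e-th
   term u_e is eventually at least #F / M^d. Points within O(1/M) of the boundary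
   hyperplane of H number O(M^(d-1)), so dropping that condition costs O(1/M).
   Taking for F the truncated set at level e_0 itself (M = p^e_0 q) shows that u
   is bounded and almost nondecreasing, hence convergent. Taking for F the
   finitely many cells of mesh 1/M that meet the p-body within H, which all meet
   Delta_q for q large, bounds the limit below by #F / M^d - O(1/M), and #F / M^d
   bounds the Lebesgue outer measure from above, so that no measurability is
   needed. *)
Require Import Defs.
From mathcomp Require Import all_boot all_order all_algebra.
From mathcomp Require Import finmap zify ring lra.
From mathcomp Require Import all_classical all_reals all_analysis.

Set Implicit Arguments.
Unset Strict Implicit.
Unset Printing Implicit Defensive.

Import Order.TTheory GRing.Theory Num.Theory.
Import numFieldNormedType.Exports.

Local Open Scope classical_set_scope.
Local Open Scope ring_scope.

(** * Semigroups of lattice points and lattice cubes *)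

Lemma eventually_all_seq (I : eqType) (l : seq I) (P : I -> nat -> Prop) :
  (forall z, z \in l -> exists n0, forall n, (n0 <= n)%N -> P z n) ->
  exists n0, forall n, (n0 <= n)%N -> forall z, z \in l -> P z n.
Proof.
elim: l => [|z l IH] h; first by exists 0%N.
have [z' z'l|n1 h1] := IH; first by apply: h; rewrite inE z'l orbT.
have [|n2 h2] := h z; first by rewrite mem_head.
exists (maxn n1 n2) => n; rewrite geq_max => /andP[n1n n2n] z'.
by rewrite inE => /predU1P[->|z'l]; [exact: h2|exact: h1].
Qed.

Section Semigroups.
Context {d : nat} {S : set 'rV[int]_d} (semiS : semigroup S).

Lemma semigroupD s t : S s -> S t -> S (s + t).
Proof. by move=> Ss St; apply: semiS.2; exists s => //; exists t. Qed.

Lemma semigroupMn s n : S s -> S (s *+ n).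
Proof.
by move=> Ss; elim: n => [|n IH]; [exact: semiS.1|rewrite mulrS; exact: semigroupD].
Qed.

Lemma semigroup_sum (I : Type) (r : seq I) (f : I -> 'rV[int]_d) :
  (forall i, S (f i)) -> S (\sum_(i <- r) f i).
Proof.
move=> Sf; elim/big_ind: _ => //; first exact: semiS.1.
exact: semigroupD.
Qed.

(** If z = s1 - s2 with s1 and s2 in [S], then s2 shifts z into [S]. The shifts found for the
    entries of the list can be added up, [S] being closed under addition. *)
Lemma common_shift (l : seq 'rV[int]_d) : minkowski_sub S S = setT ->
  exists2 s, S s & forall z, z \in l -> S (z + s).
Proof.
move=> SST; elim: l => [|z l [s Ss hs]]; first by exists 0 => //; exact: semiS.1.
have [s1 Ss1 [s2 Ss2 zE]] : minkowski_sub S S z by rewrite SST.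
exists (s + s2); first exact: semigroupD.
move=> z'; rewrite inE => /predU1P[->|z'l].
  rewrite -zE (_ : s1 - s2 + (s + s2) = s1 + s); first exact: semigroupD.
  by rewrite addrACA [- s2 + s2]addNr addr0.
by rewrite addrA; apply: semigroupD => //; exact: hs.
Qed.

End Semigroups.

Definition zcube (d n : nat) : seq 'rV[int]_d :=
  [seq \row_i ((f i : nat)%:Z - n%:Z) | f : {ffun 'I_d -> 'I_(n.*2.+1)}].

Lemma mem_zcube d n (z : 'rV[int]_d) :
  (forall i, `|z 0 i| <= n%:Z) -> z \in zcube d n.
Proof.
move=> zn; have zn0 i : 0 <= z 0 i + n%:Z.
  by have := zn i; rewrite ler_norml => /andP[]; lia.
apply/mapP; exists [ffun i => inord (absz (z 0 i + n%:Z))]; first by rewrite mem_enum.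
apply/rowP => i; rewrite mxE ffunE inordK.
  by rewrite gez0_abs ?zn0// addrK.
by have := zn i; rewrite ler_norml => /andP[]; have := zn0 i; lia.
Qed.

Lemma size_zcube d n : size (zcube d n) = (n.*2.+1 ^ d)%N.
Proof. by rewrite size_map -cardE card_ffun !card_ord. Qed.

Lemma lattice_embedE (R : realType) d (z : 'rV[int]_d) i :
  (lattice_embed R z) 0 i = (z 0 i)%:~R.
Proof. by rewrite mxE. Qed.

(* Rounding the coefficients down leaves one of finitely many remainders, and a
   single element of the semigroup shifts all of them into it. *)
Lemma cone_conductor (R : realType) d (S : set 'rV[int]_d) (I : finType)
    (s : I -> 'rV[int]_d) :
  semigroup S -> minkowski_sub S S = setT -> (forall j, S (s j)) ->
  exists2 t, S t & forall (y : 'rV[int]_d) (lambda : I -> R),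
    (forall j, 0 <= lambda j) ->
    (forall i, (y 0 i)%:~R = \sum_j lambda j * (s j 0 i)%:~R) ->
    S (y + t).
Proof.
move=> semiS SST Ss.
(* The remainder has coefficients in [0, 1), so the sum of all |s_j,i| bounds each of its
   coordinates. *)
pose B := (\sum_j \sum_i absz (s j 0%R i))%N.
have [t St ht] := common_shift semiS (zcube d B) SST.
exists t => // y lambda lambda0 yE.
pose r := y - \sum_j s j *+ Num.truncn (lambda j).
have -> : y + t = (\sum_j s j *+ Num.truncn (lambda j)) + (r + t).
  by rewrite /r addrA addrCA subrr addr0.
apply: semigroupD => //.
  by apply: semigroup_sum => // j; exact: semigroupMn.
apply/ht/mem_zcube => i.
rewrite -(@ler_int R) intr_norm.
have -> : (r 0 i)%:~R =
    \sum_j (lambda j - (Num.truncn (lambda j))%:R) * (s j 0 i)%:~R :> R.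
  rewrite !mxE intrB yE summxE rmorph_sum -sumrB; apply: eq_bigr => j _.
  by rewrite mulmxnE rmorphMn/= -mulr_natl mulrBl.
apply: le_trans (ler_norm_sum _ _ _) _.
rewrite -pmulrn /B natr_sum; apply: ler_sum => j _.
apply: (@le_trans _ _ ((absz (s j 0 i))%:R)); last first.
  by rewrite ler_nat (bigD1 i)//= leq_addr.
rewrite normrM -intr_norm natr_absz -[leRHS]mul1r ler_wpM2r//.
have /andP[l1 l2] := truncn_itv (lambda0 j).
rewrite ger0_norm ?subr_ge0//.
by rewrite lerBlDl -natr1 in l2 *; rewrite ltW.
Qed.

(** * Pointed cones and absorbing shifts *)

Lemma inner_continuous (R : realType) d (a : 'rV[R]_d) :
  continuous (fun v : 'rV[R]_d => inner v a).
Proof.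
move=> v; rewrite /inner.
elim: (index_enum _) => [|i r IH].
  rewrite (_ : (fun _ => _) = cst 0); first exact: cst_continuous.
  by apply/funext => w; rewrite big_nil.
rewrite (_ : (fun _ => _) = (fun w : 'rV_d => w 0 i * a 0 i) \+
    (fun w : 'rV_d => \sum_(j <- r) w 0 j * a 0 j)); last first.
  by apply/funext => w; rewrite big_cons.
apply: cvgD IH; apply: cvgM; last exact: cvg_cst.
exact: coord_continuous.
Qed.

Lemma ler_coord_norm (R : realType) d (v : 'rV[R]_d) i : `|v 0 i| <= `|v|.
Proof.
by rewrite [leRHS]/Num.norm/= mx_normrE; apply/bigmax_geP; right; exists (0, i).
Qed.

(** On the unit vectors of [C], a compact set, the form (-, a) attains a positive minimum; by
    homogeneity [B] can be its inverse. This is what makes [C] cut by a truncating halfspace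
    bounded. *)
Lemma positive_on_bound (R : realType) d (C : set 'rV[R]_d) (a : 'rV[R]_d) :
  convex_cone C -> closed C -> positive_on C a ->
  exists2 B, 0 <= B & forall v, C v -> forall i, `|v 0 i| <= B * inner v a.
Proof.
move=> [_ _ CZ] clC pos.
pose K := C `&` [set v | `|v| = 1].
have KZ v : C v -> v <> 0 -> K (`|v|^-1 *: v).
  move=> Cv v0; have nv : `|v| != 0 by rewrite normr_eq0; exact/eqP.
  by split; [apply: CZ => //; rewrite invr_ge0|rewrite /= normrZ normfV normr_id mulVf].
(* Without unit vectors [C] is reduced to 0, and [B] = 0 works. *)
have [K0|/set0P K0] := eqVneq K set0.
  exists 0 => // v Cv i; rewrite mul0r; apply: contrapT => vi.
  have : K (`|v|^-1 *: v).
    by apply: KZ => // v0; apply: vi; rewrite v0 mxE normr0.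
  by rewrite K0.
have compK : compact K.
  apply: bounded_closed_compact.
    by exists 1; split; [exact: real1|move=> x x1 v [_ /= ->]; exact: ltW].
  apply: closedI => //.
  apply: (@preimage_closed _ _ (fun v : 'rV[R]_d => `|v|) [set 1]).
    by move=> v _; exact: norm_continuous.
  exact: closed_eq.
have [u] := EVT_min_rV K0 compK (continuous_subspaceT (@inner_continuous R d a)).
rewrite inE => -[Cu /= u1] umin.
have u0 : 0 < inner u a.
  by apply: pos => // u0; move: u1; rewrite u0 normr0 => /eqP; rewrite eq_sym oner_eq0.
exists (inner u a)^-1; first by rewrite invr_ge0 ltW.
move=> v Cv i; apply: le_trans (ler_coord_norm v i) _.
rewrite mulrC ler_pdivlMr//.
have [->|/eqP v0] := eqVneq v 0.
  by rewrite normr0 mul0r /inner big1// => j _; rewrite mxE mul0r.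
have /umin : `|v|^-1 *: v \in K by rewrite inE; exact: KZ.
have nv : 0 < `|v| by rewrite normr_gt0; exact/eqP.
rewrite (_ : inner (_ *: v) a = `|v|^-1 * inner v a); last first.
  by rewrite /inner mulr_sumr; apply: eq_bigr => j _; rewrite mxE mulrA.
by rewrite mulrC ler_pdivlMr// mulrC.
Qed.

(** Some finite conic combination g is within e / 2 of c. Rounding the coefficients n lambda_j down
    moves g by at most B / n in each coordinate, and n is taken larger than B / (e / 2). *)
Lemma coneS_approx (R : realType) d (S : set 'rV[int]_d) (c : 'rV[R]_d) (e : R) :
  semigroup S -> coneS R S c -> 0 < e ->
  exists s n, [/\ S s, (0 < n)%N &
    forall i, `|c 0 i - (s 0 i)%:~R / n%:R| <= e].
Proof.
move=> semiS cC e0; have e20 : 0 < e / 2 by rewrite divr_gt0.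
have [g [[m [lambda [u [lambda0 uS gE]]]] cg]] := cC _ (nbhsx_ballx c _ e20).
have [s sP] : {s : 'I_m -> 'rV[int]_d & forall j, S (s j) /\ lattice_embed R (s j) = u j}.
  apply: (@choice _ _ (fun j z => S z /\ lattice_embed R z = u j)) => j.
  by have [z Sz zE] := uS j; exists z.
pose B : R := \sum_j \sum_i `|(s j 0 i)%:~R|.
have B0 : 0 <= B by apply: sumr_ge0 => j _; exact: sumr_ge0.
pose n := (Num.truncn (B / (e / 2))).+1.
have n0 : 0 < n%:R :> R by rewrite ltr0n.
exists (\sum_j s j *+ Num.truncn (n%:R * lambda j)), n; split => //.
  apply: semigroup_sum => // j; apply: semigroupMn => //; exact: (sP j).1.
move=> i; rewrite (le_trans (ler_distD (g 0 i) _ _))//.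
rewrite [leRHS](splitr e) lerD//.
  by move: cg => [_ /(_ 0 i)] /ltW.
have -> : g 0 i - ((\sum_j s j *+ Num.truncn (n%:R * lambda j)) 0 i)%:~R / n%:R =
    \sum_j (n%:R * lambda j - (Num.truncn (n%:R * lambda j))%:R) * (s j 0 i)%:~R / n%:R.
  rewrite gE !summxE rmorph_sum mulr_suml -sumrB; apply: eq_bigr => j _.
  rewrite -(sP j).2 !mxE mulmxnE rmorphMn/= -mulr_natl !mulrBl.
  by congr (_ - _); field; rewrite gt_eqF.
rewrite -mulr_suml normrM normfV (ger0_norm (ltW n0)) ler_pdivrMr//.
apply: (@le_trans _ _ B); last first.
  by rewrite mulrC -ler_pdivrMr// ltW// /n truncnS_gt.
apply: le_trans (ler_norm_sum _ _ _) _; apply: ler_sum => j _.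
apply: (@le_trans _ _ `|(s j 0 i)%:~R|); last first.
  by rewrite (bigD1 i)//= lerDl sumr_ge0.
rewrite normrM -[leRHS]mul1r ler_wpM2r//.
have /truncn_itv/andP[l1 l2] : 0 <= n%:R * lambda j by rewrite mulr_ge0.
rewrite ger0_norm ?subr_ge0//.
by rewrite lerBlDl -natr1 in l2 *; rewrite ltW.
Qed.

(** One [W] serves all c and M; only the threshold [N0] depends on them. The radius 2 / M leaves 1 /
    M for replacing a point of Delta_q by a lattice point over M, and 1 / M for the position inside
    a cell. *)
Definition absorbing_shift (R : realType) d (S : set 'rV[int]_d) (W : 'rV[int]_d) :=
  forall (c : 'rV[R]_d) M, coneS R S c -> (0 < M)%N ->
    exists N0, forall N (y : 'rV[int]_d), (N0 <= N)%N -> (0 < N)%N ->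
      (forall i, `|(y 0 i)%:~R / N%:R - c 0 i - (W 0 i)%:~R / M%:R| <= 2 / M%:R) ->
      S y.

(* With e_i = a_i - b_i, a_i, b_i in S, and W = 4 sum_i (a_i + b_i), every
   W + sum_i mu_i e_i with |mu_i| <= 4 is the nonnegative combination
   sum_i (4 + mu_i) a_i + (4 - mu_i) b_i. *)
Lemma absorbing_shift_exists (R : realType) d (S : set 'rV[int]_d) :
  semigroup S -> minkowski_sub S S = setT -> exists W, absorbing_shift R S W.
Proof.
move=> semiS SST.
have [ab abP] : {ab : 'I_d -> 'rV[int]_d * 'rV[int]_d & forall i,
    [/\ S (ab i).1, S (ab i).2 & (ab i).1 - (ab i).2 = delta_mx 0 i]}.
  apply: (@choice _ _ (fun i ab => [/\ S ab.1, S ab.2 & ab.1 - ab.2 = delta_mx 0 i])).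
  move=> i; have : minkowski_sub S S (delta_mx 0 i) by rewrite SST.
  by move=> [a Sa [b Sb abE]]; exists (a, b).
exists (\sum_i ((ab i).1 + (ab i).2) *+ 4) => c M Cc M0.
have M0' : 0 < M%:R :> R by rewrite ltr0n.
have [s [n [Ss n0 sc]]] := coneS_approx semiS Cc (divr_gt0 ltr01 M0').
have n0' : 0 < n%:R :> R by rewrite ltr0n.
pose I := ('I_1 + ('I_d + 'I_d))%type.
pose gen (j : I) := match j with
  inl _ => s | inr (inl i) => (ab i).1 | inr (inr i) => (ab i).2 end.
have Sgen j : S (gen j) by case: j => [_|[i|i]] //=; have [] := abP i.
have [t St ht] := cone_conductor R semiS SST Sgen.
(* Beyond this threshold |t_i| / N is at most 1 / M. *)
exists (M * \sum_i absz (t 0%R i))%N => N y N0 N1 yP.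
have N1' : 0 < N%:R :> R by rewrite ltr0n.
set W := \sum_i _ in yP.
(* Chosen so that y - t = (N / n) s + (N / M) (W + mu). The bound 4 is 2 from the hypothesis on y,
   plus 1 for s / n against c, plus 1 for t / N. *)
pose mu i : R := M%:R * ((y 0 i - t 0 i)%:~R / N%:R - (s 0 i)%:~R / n%:R) - (W 0 i)%:~R.
have mu4 i : `|mu i| <= 4.
  have tN : `|(t 0 i)%:~R / N%:R| <= 1 / M%:R :> R.
    rewrite normrM normfV (ger0_norm (ltW N1')) ler_pdivrMr// mulrAC.
    rewrite ler_pdivlMr// mul1r -intr_norm -natr_absz -natrM ler_nat.
    by rewrite mulnC (leq_trans _ N0)// leq_mul2l (bigD1 i)//= leq_addr orbT.
  have -> : mu i = M%:R * (((y 0 i)%:~R / N%:R - c 0 i - (W 0 i)%:~R / M%:R)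
     + (c 0 i - (s 0 i)%:~R / n%:R) - (t 0 i)%:~R / N%:R).
    by rewrite /mu rmorphB/=; field; rewrite !gt_eqF.
  rewrite normrM (ger0_norm (ltW M0')) mulrC -ler_pdivlMr//.
  have := yP i; have := sc i; move: tN.
  move: (_ / N%:R) (c 0 i - _) (_ - _ / M%:R) => x1 x2 x3 h1 h2 h3.
  apply: le_trans (ler_normB _ _) _; apply: le_trans (lerD (ler_normD _ _) (lexx _)) _.
  by move: M%:R^-1 h1 h2 h3 => m; lra.
have -> : y = (y - t) + t by rewrite subrK.
pose lambda (j : I) : R := match j with
  inl _ => N%:R / n%:R | inr (inl i) => N%:R / M%:R * (4 + mu i)
  | inr (inr i) => N%:R / M%:R * (4 - mu i) end.
apply: (ht _ lambda).
  move=> [_|[i|i]] /=; rewrite ?divr_ge0// mulr_ge0// ?divr_ge0//.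
    by have := mu4 i; rewrite ler_norml; lra.
  by have := mu4 i; rewrite ler_norml; lra.
move=> i; rewrite big_sumType/= big_ord1 big_sumType/= -big_split/=.
have -> : (y - t) 0 i = y 0 i - t 0 i by rewrite !mxE.
have abE j : ((ab j).1 0 i)%:~R = ((ab j).2 0 i)%:~R + (i == j)%:R :> R.
  have [_ _ /rowP/(_ i)] := abP j; rewrite !mxE eqxx/= => /eqP.
  by rewrite subr_eq => /eqP ->; rewrite rmorphD/= addrC; case: (i == j).
transitivity (N%:R / n%:R * (s 0 i)%:~R + N%:R / M%:R * ((W 0 i)%:~R + mu i) : R).
  by rewrite /mu; field; rewrite !gt_eqF.
congr (_ + _).
have -> : mu i = \sum_j mu j * (i == j)%:R.
  rewrite (bigD1 i)//= eqxx mulr1 big1 ?addr0// => j ji.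
  by rewrite eq_sym (negbTE ji) mulr0.
rewrite /W summxE rmorph_sum -big_split/= mulr_sumr; apply: eq_bigr => j _.
rewrite mulmxnE mxE rmorphMn rmorphD/= -mulr_natr abE; ring.
Qed.

(** * Inner products and lattice points near a hyperplane *)

Lemma innerDl (R : realType) d (v w a : 'rV[R]_d) :
  inner (v + w) a = inner v a + inner w a.
Proof. by rewrite /inner -big_split; apply: eq_bigr => i _; rewrite mxE mulrDl. Qed.

Lemma innerZl (R : realType) d (t : R) (v a : 'rV[R]_d) :
  inner (t *: v) a = t * inner v a.
Proof. by rewrite /inner mulr_sumr; apply: eq_bigr => i _; rewrite mxE mulrA. Qed.

Lemma inner_le_norm (R : realType) d (v a : 'rV[R]_d) (t : R) :
  (forall i, `|v 0 i| <= t) -> inner v a <= t * \sum_i `|a 0 i|.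
Proof.
move=> vt; rewrite /inner mulr_sumr; apply: ler_sum => i _.
by rewrite (le_trans (ler_norm _))// normrM ler_wpM2r.
Qed.

Lemma lattice_embedD (R : realType) d (y z : 'rV[int]_d) :
  lattice_embed R (y + z) = lattice_embed R y + lattice_embed R z.
Proof. by apply/rowP => i; rewrite !mxE rmorphD. Qed.

Lemma lattice_embedMn (R : realType) d (y : 'rV[int]_d) n :
  lattice_embed R (y *+ n) = n%:R *: lattice_embed R y.
Proof. by apply/rowP => i; rewrite !(mxE, mulmxnE) rmorphMn/= mulr_natl. Qed.

(* The translates of the slab by multiples of g, (g, a) = 2 K sum_i |a_i|, are
   pairwise disjoint and M of them fit in a box of side O(M). *)
Lemma slab_count (R : realType) d (a : 'rV[R]_d) (beta : R) (K B M : nat)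
    (F : seq 'rV[int]_d) :
  uniq F -> (0 < M)%N ->
  (forall z, z \in F -> forall i, `|z 0 i| <= (B * M)%N%:Z) ->
  (forall z, z \in F -> beta - K%:R * \sum_i `|a 0 i| <=
      inner (lattice_embed R z) a < beta + K%:R * \sum_i `|a 0 i|) ->
  (size F * M <= ((B + K.*2).*2.+1 * M) ^ d)%N.
Proof.
move=> uF M0 FB Fslab; set L := K%:R * _ in Fslab.
have L0 : 0 <= L by rewrite mulr_ge0// sumr_ge0.
pose g : 'rV[int]_d := \row_i (sgz (a 0 i) *+ K.*2).
have gE : inner (lattice_embed R g) a = 2 * L.
  rewrite /L mulrA mulr_sumr; apply: eq_bigr => i _.
  by rewrite !mxE rmorphMn/= -sgrEz [in RHS]normrEsg -mulr_natl -natrM mul2n mulrA.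
pose G := [seq z + g *+ j | z <- F, j <- iota 0 M].
have inG z j : inner (lattice_embed R (z + g *+ j)) a =
    inner (lattice_embed R z) a + j%:R * (2 * L).
  by rewrite lattice_embedD lattice_embedMn innerDl innerZl gE.
have disj z z' j j' : z \in F -> z' \in F -> (j < j')%N ->
    z + g *+ j <> z' + g *+ j'.
  move=> zF z'F jj' /(congr1 (fun u => inner (lattice_embed R u) a)).
  rewrite !inG; have /andP[_] := Fslab z zF; have /andP[+ _] := Fslab z' z'F.
  have : j%:R * (2 * L) + 2 * L <= j'%:R * (2 * L).
    by rewrite -[X in _ + X]mul1r -mulrDl natr1 ler_wpM2r ?ler_nat// mulr_ge0.
  by lra.
have uG : uniq G.
  apply: allpairs_uniq => //; first exact: iota_uniq.
  move=> _ _ /allpairsPdep[z [j [zF _ ->]]] /allpairsPdep[z' [j' [z'F _ ->]]] /= e.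
  have jj' : j = j'.
    case: (ltngtP j j') => // jj'; first by case: (disj _ _ _ _ zF z'F jj').
    by case: (disj _ _ _ _ z'F zF jj').
  by move: e; rewrite jj' => /addIr ->.
have -> : (size F * M)%N = size G by rewrite size_allpairs size_iota.
apply: (@leq_trans (size (zcube d ((B + K.*2) * M)))); last first.
  rewrite size_zcube; have [->//|d0] := posnP d.
  (* A cube of radius (B + 2K) M has 2 (B + 2K) M + 1 lattice points per side; the extra 1 is at
     most M. *)
  by rewrite leq_exp2r// mulSn -doubleMl -add1n leq_add2r.
apply: uniq_leq_size => // _ /allpairsP[[z j] /= [zF + ->]].
rewrite mem_iota add0n /= => jM; apply: mem_zcube => i.
rewrite !(mxE, mulmxnE) (le_trans (ler_normD _ _))// mulnDl PoszD lerD ?FB//.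
rewrite -mulrnA normrMn normr_sgz -mulr_natr natz -PoszM lez_nat.
apply: (@leq_trans (1 * (K.*2 * j))); first by rewrite leq_mul2r leq_b1 orbT.
by rewrite mul1n leq_mul2l ltnW ?orbT.
Qed.

(** * Subdivided cells and cardinalities *)

Definition cell_point d k (W z : 'rV[int]_d) (v : {ffun 'I_d -> 'I_k}) :=
  (z + W) *+ k + \row_i (v i : nat)%:Z.

(** In each coordinate, Euclidean division by k recovers z + W as quotient and v as remainder. *)
Lemma cell_point_inj d k (W : 'rV[int]_d) z z' (v v' : {ffun 'I_d -> 'I_k}) :
  cell_point W z v = cell_point W z' v' -> z = z' /\ v = v'.
Proof.
move=> /rowP e.
suff zv i : z 0 i = z' 0 i /\ v i = v' i.
  by split; [apply/rowP|apply/ffunP] => i; have [] := zv i.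
have quot (u : int) (w : 'I_k) : ((u * k%:Z + w%:Z) %/ k%:Z)%Z = u.
  have k0 : k%:Z != 0 by case: w => m; case: (k).
  by rewrite divzMDl// divz_small ?addr0//= ltz_nat ltn_ord.
have := e i; rewrite !(mxE, mulmxnE) -(mulr_natr (z _ _ + _)) -(mulr_natr (z' _ _ + _)).
rewrite natz => ei.
have /(congr1 (fun u => (u %/ k%:Z)%Z)) := ei; rewrite !quot => /addIr xx'.
by split=> //; apply/val_inj; move: ei; rewrite xx' => /addrI[].
Qed.

Lemma cell_points_uniq d k (F : seq 'rV[int]_d) (W : 'rV[int]_d) : uniq F ->
  uniq [seq cell_point W z v | z <- F, v <- enum {: {ffun 'I_d -> 'I_k}}].
Proof.
move=> uF; apply: allpairs_uniq => //; first exact: enum_uniq.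
by move=> [z v] [z' v'] _ _ /cell_point_inj[-> ->].
Qed.

Lemma leq_size_fset_set (T : choiceType) (X : set T) (s : seq T) :
  finite_set X -> uniq s -> (forall x, x \in s -> X x) ->
  (size s <= #|` fset_set X|)%N.
Proof.
move=> finX us sX; apply: uniq_leq_size => // x /sX Xx.
by rewrite [_ \in _](in_fset_set finX) inE.
Qed.

Lemma sub_seq_card (T : choiceType) (X : set T) (s : seq T) :
  (forall x, X x -> x \in s) ->
  finite_set X /\ (#|` fset_set X| <= size s)%N.
Proof.
move=> Xs; have finX : finite_set X.
  by apply: (sub_finite_set _ (finite_seq s)).
split=> //; apply: uniq_leq_size => [|x]; first exact: fset_uniq.
by rewrite [_ \in enum_fset _](in_fset_set finX) inE => /Xs.
Qed.

Lemma sub_coneS (R : realType) d (S : set 'rV[int]_d) z :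
  S z -> coneS R S (lattice_embed R z).
Proof.
move=> Sz; apply: subset_closure.
exists 1%N, (fun=> 1), (fun=> lattice_embed R z).
by split=> [//|_|]; [exists z|rewrite big_ord1 scale1r].
Qed.

(** * Lower bound for the number of truncated points *)

Section Counting.
Context {R : realType} {d p : nat} (hp : prime p).
Context {S : set 'rV[int]_d} (hS : standard R S).
Context {T : nat -> set 'rV[int]_d} (hT : p_system p S T).
Context (a : 'rV[R]_d) (alpha : R).

Local Notation H := [set v : 'rV[R]_d | inner v a < alpha].
Local Notation normL1 := (\sum_i `|a 0 i|).

Let semiS : semigroup S. Proof. by case: hS. Qed.

Lemma truncated_points_sub q e z : power_of p q ->
  truncated_points p S T H q e z ->
  S z /\ inner (lattice_embed R z) a < (p ^ e * q)%:R * alpha.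
Proof.
move=> qp [[_ [t Tt <-] [s Ss zE]] [h /= ha hE]]; split.
  rewrite -zE; apply: semigroupD => //.
  rewrite -natz scaler_nat; apply: semigroupMn => //.
  by have [[TS _] _] := hT qp; exact: TS.
have [e0 qE] := qp.
by rewrite -hE innerZl ltr_pM2l// ltr0n muln_gt0 qE !expn_gt0 prime_gt0.
Qed.

Lemma truncated_points_bounded (B : R) (r : nat) q e z :
  (forall v, coneS R S v -> forall i, `|v 0 i| <= B * inner v a) -> 0 <= B ->
  B * alpha <= r%:R -> power_of p q ->
  truncated_points p S T H q e z -> forall i, `|z 0 i| <= (r * (p ^ e * q))%N%:Z.
Proof.
move=> HB B0 Br qp /(truncated_points_sub qp)[Sz za] i.
rewrite -(ler_int R) intr_norm -(lattice_embedE R).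
apply: le_trans (HB _ (sub_coneS Sz) i) _.
apply: (@le_trans _ _ (B * ((p ^ e * q)%:R * alpha))).
  by rewrite ler_wpM2l// ltW.
by rewrite -pmulrn [(r * _)%N]mulnC [leRHS]natrM mulrCA ler_wpM2l.
Qed.

Lemma truncated_points_finite (B : R) (r : nat) q e :
  (forall v, coneS R S v -> forall i, `|v 0 i| <= B * inner v a) -> 0 <= B ->
  B * alpha <= r%:R -> power_of p q ->
  finite_set (truncated_points p S T H q e) /\
  (#|` fset_set (truncated_points p S T H q e)| <=
     (r * (p ^ e * q)).*2.+1 ^ d)%N.
Proof.
move=> HB B0 Br qp; rewrite -size_zcube; apply: sub_seq_card => z zA.
by apply: mem_zcube; exact: (truncated_points_bounded HB B0 Br qp zA).
Qed.

(** The inclusion of p T_q in T_(pq) lets t / q be rewritten as (p t) / (p q). Finitely many points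
    of the p-body therefore lie in a common Delta_q. *)
Lemma le_Delta_q f g x : (f <= g)%N ->
  Delta_q R S T (p ^ f) x -> Delta_q R S T (p ^ g) x.
Proof.
move=> /subnK <-; elim: (g - f)%N => // n IH fx; have {fx IH} := IH fx.
move=> [_ [_ [t Tt <-] <-] [c Cc xE]]; rewrite addSn expnS.
have [_ pT] := hT (ex_intro _ (n + f)%N (erefl (p ^ (n + f))%N)).
have p0 : p%:R != 0 :> R by rewrite pnatr_eq0 -lt0n prime_gt0.
exists ((p ^ (n + f))%:R^-1 *: lattice_embed R t); last by exists c.
exists (lattice_embed R (p%:Z *: t)).
  by exists (p%:Z *: t) => //; apply: pT; exists t.
rewrite -natz scaler_nat lattice_embedMn scalerA natrM invfM.
by rewrite mulrAC mulVf ?mul1r.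
Qed.

(* The points k (z + W) + v with 0 <= v_i < k, N = M k, z in F, all belong to the
   truncated set: p^e t + S contains the lattice points near N x. *)
Lemma card_truncated_points_ge (W : 'rV[int]_d) (K f m : nat)
    (F : seq 'rV[int]_d) :
  absorbing_shift R S W ->
  (forall i, `|W 0 i| < K%:Z) -> uniq F ->
  (forall e, finite_set (truncated_points p S T H (p ^ f) e)) ->
  (forall z, z \in F ->
     inner (lattice_embed R z) a < (p ^ m)%:R * alpha - K%:R * normL1 /\
     exists2 x, Delta_q R S T (p ^ f) x &
       forall i, `|x 0 i - (z 0 i)%:~R / (p ^ m)%:R| <= 1 / (p ^ m)%:R) ->
  exists E, forall e, (E <= e)%N -> (m <= e + f)%N /\
    (size F * (p ^ (e + f - m)) ^ d <=
      #|` fset_set (truncated_points p S T H (p ^ f) e)|)%N.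
Proof.
move=> HW WK uF finA FP; set M := (p ^ m)%N in FP.
have M0 : (0 < M)%N by rewrite expn_gt0 prime_gt0.
have M0' : 0 < M%:R :> R by rewrite ltr0n.
have [E HE] : exists E, forall e, (E <= e)%N -> forall z, z \in F -> (m <= e + f)%N ->
    forall v : {ffun 'I_d -> 'I_(p ^ (e + f - m))},
    truncated_points p S T H (p ^ f) e (cell_point W z v).
  apply: eventually_all_seq => z /FP[za [x [_ [_ [t Tt <-] <-] [c Cc xE]] xz]].
  have [N0 HN0] := HW c M Cc M0.
  exists N0 => e N0e me v; set k := (p ^ (e + f - m))%N in v *.
  have NE : (p ^ e * p ^ f = M * k)%N by rewrite -!expnD subnKC.
  have k0 : (0 < k)%N by rewrite expn_gt0 prime_gt0.
  have k0' : 0 < k%:R :> R by rewrite ltr0n.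
  have pe0 : (p ^ e)%:R != 0 :> R by rewrite pnatr_eq0 -lt0n expn_gt0 prime_gt0.
  have pf0 : (p ^ f)%:R != 0 :> R by rewrite pnatr_eq0 -lt0n expn_gt0 prime_gt0.
  have NE' : (p ^ e)%:R * (p ^ f)%:R = M%:R * k%:R :> R by rewrite -!natrM NE.
  have vk i : (v i)%:R <= k%:R :> R by rewrite ler_nat ltnW.
  split.
    (* The difference of the point and p^e t is in [S] because, divided by N, it is within 2 / M of
       c + W / M. *)
    exists ((p ^ e)%:Z *: t); first by exists t.
    exists (cell_point W z v - (p ^ e)%:Z *: t); last by rewrite addrC subrK.
    apply: (HN0 (p ^ e * p ^ f)%N).
    (* N is large enough: N0 <= e < p^e <= p^e q. *)
    - apply: leq_trans N0e _; apply: (@leq_trans (p ^ e)%N).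
        by rewrite ltnW// ltn_expl// prime_gt1.
      by rewrite leq_pmulr// expn_gt0 prime_gt0.
    - by rewrite NE muln_gt0 M0.
    move=> i; rewrite !(mxE, mulmxnE) rmorphB rmorphD rmorphM rmorphMn rmorphD/=.
    have xiE : c 0 i = x 0 i - (t 0 i)%:~R / (p ^ f)%:R.
      by rewrite -xE !mxE mulrC addrAC subrr add0r.
    have -> : ((((z 0 i)%:~R + (W 0 i)%:~R) *+ k + (v i)%:~R
        - (p ^ e)%:Z%:~R * (t 0 i)%:~R) / (p ^ e * p ^ f)%:R - c 0 i - (W 0 i)%:~R / M%:R)
      = - (x 0 i - (z 0 i)%:~R / M%:R) + (v i)%:R / (M%:R * k%:R) :> R.
      rewrite natrM xiE -(mulr_natr (_ + _)) -!pmulrn NE'.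
      have -> : (t 0 i)%:~R / (p ^ f)%:R = (p ^ e)%:R * (t 0 i)%:~R / (M%:R * k%:R) :> R.
        by rewrite -NE' -mulf_div divff// mul1r.
      by field; rewrite !gt_eqF.
    rewrite (le_trans (ler_normD _ _))// normrN (_ : 2 / M%:R = 1 / M%:R + 1 / M%:R).
      rewrite lerD ?xz// ger0_norm ?divr_ge0// ?mulr_ge0//.
      by rewrite ler_pdivrMr ?mulr_gt0// mul1r mulrA mulVf ?gt_eqF// mul1r.
    by rewrite -mulrDl.
  exists ((p ^ e * p ^ f)%:R^-1 *: lattice_embed R (cell_point W z v)); last first.
    by rewrite scalerA divff ?scale1r// natrM mulf_neq0.
  rewrite /= innerZl natrM NE' mulrC ltr_pdivrMr ?mulr_gt0//.
  rewrite /cell_point mulrnDl -addrA lattice_embedD innerDl lattice_embedMn innerZl.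
  (* Since |W_i| + 1 <= K and v_i < k, each |k W_i + v_i| is at most k K; the margin [K%:R * normL1]
     pays for this. *)
  have vW : inner (lattice_embed R (W *+ k + \row_i (v i : nat)%:Z)) a <=
      k%:R * (K%:R * normL1).
    rewrite mulrA; apply: inner_le_norm => i.
    rewrite lattice_embedE !(mxE, mulmxnE) -intr_norm -natrM [leRHS]pmulrn ler_int.
    apply: le_trans (ler_normD _ _) _; rewrite normrMn (ger0_norm (_ : 0 <= (v i)%:Z))//.
    have := ltn_ord (v i); have := WK i; rewrite -mulr_natl natz.
    rewrite PoszM -lezD1 -(ler_pM2l (_ : 0 < k%:Z))// => hW hv.
    apply: le_trans hW; rewrite mulrDr mulr1 lerD2l; exact: ltW.
  apply: le_lt_trans (lerD (lexx _) vW) _.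
  by rewrite -mulrDr [ltRHS]mulrA [ltRHS]mulrC ltr_pM2l// [alpha * _]mulrC -ltrBrDr.
exists (maxn E m) => e; rewrite geq_max => /andP[Ee me].
have mef : (m <= e + f)%N by rewrite (leq_trans me)// leq_addr.
split=> //; set k := (p ^ _)%N.
have <- : size [seq cell_point W z v | z <- F, v <- enum {: {ffun 'I_d -> 'I_k}}]
    = (size F * k ^ d)%N.
  by rewrite size_allpairs -cardE card_ffun !card_ord.
apply: leq_size_fset_set => //; first exact: cell_points_uniq.
by move=> _ /allpairsP[[z v] /= [zF _ ->]]; exact: HE.
Qed.

End Counting.

(** * A convergence criterion and the volume of unions of cells *)

(** The limit is the supremum of the eventual lower bounds of u. Each u e0 - delta e0 is such a
    bound, so u e0 exceeds the supremum by at most delta e0. *)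
Lemma almost_nondecreasing_cvgn (R : realType) (u delta : nat -> R) (b : R) :
  (forall e, u e <= b) ->
  (forall eps, 0 < eps -> exists E, forall e, (E <= e)%N -> delta e <= eps) ->
  (forall e0, exists E, forall e, (E <= e)%N -> u e0 - delta e0 <= u e) ->
  cvgn u.
Proof.
move=> ub delta0 mono.
pose X := [set x : R | exists E, forall e, (E <= e)%N -> x <= u e].
have supX : has_sup X.
  split; first by exists (u 0%N - delta 0%N); exact: mono.
  by exists b => x [E /(_ E (leqnn E)) xu]; exact: le_trans xu (ub E).
apply/cvg_ex; exists (sup X); apply/cvgrPdist_le => eps eps0.
have [x [E1 xE1] xsup] := sup_adherent eps0 supX.
have [E2 dE2] := delta0 _ eps0.
near=> e.
have e1 : x <= u e by apply: xE1; near: e; exact: nbhs_infty_ge.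
have e2 : delta e <= eps by apply: dE2; near: e; exact: nbhs_infty_ge.
have e3 : u e - delta e <= sup X by apply: ub_le_sup (mono e); exact: supX.2.
by rewrite ler_norml; apply/andP; split; lra.
Unshelve. all: by end_near. Qed.

Lemma eventually_small (R : realType) (p : nat) (c eps : R) :
  (1 < p)%N -> 0 <= c -> 0 < eps ->
  exists E, forall e, (E <= e)%N -> c / (p ^ e)%:R <= eps.
Proof.
move=> p1 c0 eps0; exists (Num.truncn (c / eps)).+1 => e Ee.
rewrite ler_pdivrMr ?ltr0n ?expn_gt0 ?(ltnW p1)// mulrC -ler_pdivrMr//.
apply/ltW; apply: lt_le_trans (truncnS_gt _) _.
by rewrite ler_nat (leq_trans Ee)// ltnW// ltn_expl.
Qed.

Lemma lebesgue_outer_le_cells (R : realType) d (A : set 'rV[R]_d) (M : nat)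
    (F : seq 'rV[int]_d) : (0 < M)%N ->
  (forall x, A x -> exists2 z, z \in F &
    forall i, (z 0 i)%:~R / M%:R <= x 0 i <= ((z 0 i)%:~R + 1) / M%:R) ->
  (lebesgue_outer A <= ((size F)%:R / (M ^ d)%:R)%:E)%E.
Proof.
move=> M0 AF; have M0' : 0 < M%:R :> R by rewrite ltr0n.
(* Past the end of [F], [nth] returns 0, whose cell still has lo <= hi, as [box_cover] demands at
   every index. *)
pose lo k : 'rV[R]_d := \row_i ((nth 0 F k 0 i)%:~R / M%:R).
pose hi k : 'rV[R]_d := \row_i (((nth 0 F k 0 i)%:~R + 1) / M%:R).
have vol k : box_volume (lo k) (hi k) = (M ^ d)%:R^-1.
  rewrite /box_volume (eq_bigr (fun=> M%:R^-1)) => [|i _].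
    by rewrite prodr_const card_ord natrX exprVn.
  by rewrite !mxE -mulrBl addrAC subrr add0r mul1r.
apply: ereal_inf_lbound; exists `I_(size F), lo, hi; split.
  split=> [k i|x /AF[z zF zx]].
    by rewrite !mxE ler_pM2r ?invr_gt0// lerDl.
  exists (index z F) => /=; first by rewrite index_mem.
  by move=> i; rewrite !mxE nth_index.
rewrite esum_fset => [||k _]; [|exact: finite_II|].
  rewrite -fsbig_ord sumEFin; congr (_%:E).
  by rewrite (eq_bigr (fun=> (M ^ d)%:R^-1)) // sumr_const card_ord mulr_natl.
by rewrite vol lee_fin invr_ge0.
Qed.

(** * Existence of the limit and its lower bound *)

Section Limit.
Context {R : realType} {d p : nat} (hp : prime p).
Context {S : set 'rV[int]_d} (hS : standard R S).
Context {T : nat -> set 'rV[int]_d} (hT : p_system p S T).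
Context (a : 'rV[R]_d) (alpha : R).

Local Notation H := [set v : 'rV[R]_d | inner v a < alpha].
Local Notation normL1 := (\sum_i `|a 0 i|).

Let density q e : R := #|` fset_set (truncated_points p S T H q e)|%fset%:R
  / (p ^ (e * d) * q ^ d)%:R.

Lemma p_body_sub_coneS : p_body R p S T `<=` coneS R S.
Proof.
have [_ _ [[_ CD CZ] _ _]] := hS.
move=> _ [q qp [_ [_ [t Tt <-] <-] [c Cc <-]]].
apply: CD => //; apply: CZ; rewrite ?invr_ge0//; apply: sub_coneS.
by have [[TS _] _] := hT qp; exact: TS.
Qed.

(** The z that stay inside by the margin contribute k^d points each. The others lie in a slab about
    the hyperplane, so [slab_count] allows only O(M^(d-1)) of them; divided by M^d, this is the
    subtracted term. *)
Lemma density_ge (W : 'rV[int]_d) (K r f m : nat) (F : seq 'rV[int]_d) :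
  absorbing_shift R S W ->
  (forall i, `|W 0 i| < K%:Z) -> uniq F ->
  (forall e, finite_set (truncated_points p S T H (p ^ f) e)) ->
  (forall z, z \in F ->
     [/\ forall i, `|z 0 i| <= (r * p ^ m)%N%:Z,
       inner (lattice_embed R z) a < (p ^ m)%:R * alpha + K%:R * normL1 &
       exists2 x, Delta_q R S T (p ^ f) x &
         forall i, `|x 0 i - (z 0 i)%:~R / (p ^ m)%:R| <= 1 / (p ^ m)%:R]) ->
  exists E, forall e, (E <= e)%N ->
    (size F)%:R / ((p ^ m) ^ d)%:R - ((r + K.*2).*2.+1 ^ d)%:R / (p ^ m)%:R
      <= density (p ^ f) e.
Proof.
move=> HW WK uF finA FP; set M := (p ^ m)%N in FP *.
have M0 : (0 < M)%N by rewrite expn_gt0 prime_gt0.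
have M0' : 0 < M%:R :> R by rewrite ltr0n.
pose inside := [pred z : 'rV[int]_d |
  inner (lattice_embed R z) a < M%:R * alpha - K%:R * normL1].
have F1P z : z \in [seq z' <- F | inside z'] ->
     inner (lattice_embed R z) a < M%:R * alpha - K%:R * normL1 /\
     exists2 x, Delta_q R S T (p ^ f) x &
       forall i, `|x 0 i - (z 0 i)%:~R / M%:R| <= 1 / M%:R.
  by rewrite mem_filter => /andP[zin /FP[]].
have [E HE] := card_truncated_points_ge hp HW WK (filter_uniq inside uF) finA F1P.
have F2M : (size ([seq z' <- F | predC inside z']) * M <= ((r + K.*2).*2.+1 * M) ^ d)%N.
  apply: (slab_count (a := a) (beta := M%:R * alpha)) => //.
  - exact: filter_uniq.
  - by move=> z; rewrite mem_filter => /andP[_ /FP[]].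
  - move=> z; rewrite mem_filter /= => /andP[+ /FP[_ ->]].
    by rewrite -leNgt => ->.
exists E => e /HE[me]; rewrite /density; set k := (p ^ _)%N; set A := #|` _|%fset => FA.
have k0 : (0 < k)%N by rewrite expn_gt0 prime_gt0.
have -> : (p ^ (e * d) * (p ^ f) ^ d = M ^ d * k ^ d)%N.
  by rewrite expnM -!expnMn -!expnD subnKC.
have Md0 : 0 < (M ^ d)%:R :> R by rewrite ltr0n expn_gt0 M0.
have kd0 : 0 < (k ^ d)%:R :> R by rewrite ltr0n expn_gt0 k0.
rewrite lerBlDr; apply: (@le_trans _ _ ((size ([seq z' <- F | inside z']))%:R / (M ^ d)%:R
    + (size ([seq z' <- F | predC inside z']))%:R / (M ^ d)%:R)).
  by rewrite -mulrDl -natrD !size_filter count_predC.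
apply: lerD.
  by rewrite natrM ler_pdivlMr ?mulr_gt0// mulrA divfK ?gt_eqF// -natrM ler_nat.
rewrite ler_pdivrMr// mulrAC ler_pdivlMr// -!natrM ler_nat.
by rewrite (leq_trans F2M)// expnMn.
Qed.

(** If z = p^e t + s, then z / (p^e q) = t / q + s / (p^e q), with last term in the cone. *)
Lemma truncated_points_Delta_q f e z :
  truncated_points p S T H (p ^ f) e z ->
  Delta_q R S T (p ^ f) ((p ^ (e + f))%:R^-1 *: lattice_embed R z).
Proof.
have [_ _ [[_ _ CZ] _ _]] := hS.
move=> [[_ [t Tt <-] [s Ss zE]] _].
exists ((p ^ f)%:R^-1 *: lattice_embed R t).
  by exists (lattice_embed R t) => //; exists t.
exists ((p ^ (e + f))%:R^-1 *: lattice_embed R s).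
  by apply: CZ; [rewrite invr_ge0|exact: sub_coneS].
have pe0 : (p ^ e)%:R != 0 :> R by rewrite pnatr_eq0 -lt0n expn_gt0 prime_gt0.
rewrite -zE lattice_embedD scalerDr; congr (_ + _).
rewrite -natz scaler_nat lattice_embedMn scalerA expnD natrM invfM.
by rewrite mulrAC mulVf ?mul1r.
Qed.

(** Boundedness comes from an enclosing cube. Near monotonicity is [density_ge] for the truncated
    set of level e0, with M = p^(e0 + f) and loss c / M. *)
Lemma density_cvgn (W : 'rV[int]_d) (K r f : nat) :
  absorbing_shift R S W -> (forall i, `|W 0 i| < K%:Z) ->
  (forall e z, truncated_points p S T H (p ^ f) e z ->
     forall i, `|z 0 i| <= (r * (p ^ e * p ^ f))%N%:Z) ->
  cvgn (density (p ^ f)).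
Proof.
move=> HW WK Ar; have fp : power_of p (p ^ f) by exists f.
have cardA e : finite_set (truncated_points p S T H (p ^ f) e) /\
    (#|` fset_set (truncated_points p S T H (p ^ f) e)| <=
       (r * (p ^ e * p ^ f)).*2.+1 ^ d)%N.
  rewrite -size_zcube; apply: sub_seq_card => z zA.
  by apply: mem_zcube; exact: Ar.
have densE q e : (p ^ (e * d) * (p ^ q) ^ d = (p ^ (e + q)) ^ d)%N.
  by rewrite expnM -expnMn expnD.
pose c : R := ((r + K.*2).*2.+1 ^ d)%:R.
apply: (almost_nondecreasing_cvgn (b := (r.*2.+1 ^ d)%:R)
  (delta := fun e => c / (p ^ (e + f))%:R)).
- move=> e; rewrite /density densE ler_pdivrMr ?ltr0n ?expn_gt0 ?prime_gt0//.
  rewrite -natrM ler_nat.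
  rewrite -expnMn (leq_trans (cardA e).2)// -expnD.
  have [->//|d0] := posnP d.
  by rewrite leq_exp2r// mulSn -doubleMl -add1n leq_add2r expn_gt0 prime_gt0.
- move=> eps eps0.
  have [E HE] := eventually_small (c := c) (prime_gt1 hp) (ler0n _ _) eps0.
  by exists E => e Ee; apply: HE; rewrite (leq_trans Ee)// leq_addr.
move=> e0; rewrite {1}/density densE.
apply: (density_ge HW WK) => [|e|z]; [exact: fset_uniq|exact: (cardA e).1|].
rewrite [_ \in _](in_fset_set (cardA e0).1) inE => zA.
have [_ za] := truncated_points_sub hp hS hT fp zA.
split=> [||]; first by rewrite expnD; exact: Ar.
  by rewrite expnD (lt_le_trans za)// lerDl mulr_ge0// sumr_ge0.
(* The required point of Delta_q is z / M itself, at distance 0. *)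
exists ((p ^ (e0 + f))%:R^-1 *: lattice_embed R z).
  exact: truncated_points_Delta_q.
by move=> i; rewrite !mxE mulrC subrr normr0 divr_ge0.
Qed.

(** The cell of x has the floor of M x as its corner. Keeping only cells that meet the truncated
    p-body leaves a witness in each, to be placed later in a single Delta_q. *)
Lemma cover_p_body (r m : nat) :
  (forall x i, coneS R S x -> H x -> `|x 0 i| <= r%:R) ->
  exists F : seq 'rV[int]_d, uniq F /\
  [/\ forall x, (p_body R p S T `&` H) x -> exists2 z, z \in F &
      forall i, (z 0 i)%:~R / (p ^ m)%:R <= x 0 i <= ((z 0 i)%:~R + 1) / (p ^ m)%:R &
    forall z, z \in F -> (forall i, `|z 0 i| <= (r * p ^ m)%N%:Z) /\
      exists2 x, (p_body R p S T `&` H) x &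
      forall i, (z 0 i)%:~R / (p ^ m)%:R <= x 0 i <= ((z 0 i)%:~R + 1) / (p ^ m)%:R].
Proof.
move=> Hr; set M := (p ^ m)%N.
have M0' : 0 < M%:R :> R by rewrite ltr0n expn_gt0 prime_gt0.
pose P (z : 'rV[int]_d) := (forall i, `|z 0 i| <= (r * M)%N%:Z) /\
  exists2 x, (p_body R p S T `&` H) x &
  forall i, (z 0 i)%:~R / M%:R <= x 0 i <= ((z 0 i)%:~R + 1) / M%:R.
exists [seq z <- undup (zcube d (r * M)) | `[< P z >]].
split; first by rewrite filter_uniq// undup_uniq.
split=> [x xDH|z]; last by rewrite mem_filter => /andP[/asboolP].
pose z : 'rV[int]_d := \row_i Num.floor (M%:R * x 0 i).
have zx i : (z 0 i)%:~R / M%:R <= x 0 i <= ((z 0 i)%:~R + 1) / M%:R.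
  rewrite mxE ler_pdivrMr// ler_pdivlMr// [x 0 i * _]mulrC.
  by have /andP[-> /ltW] := floor_itv (M%:R * x 0 i); rewrite rmorphD.
have zr i : `|z 0 i| <= (r * M)%N%:Z.
  have /ler_normlP[x1 x2] := Hr x i (p_body_sub_coneS xDH.1) xDH.2.
  rewrite ler_norml mxE; apply/andP; split.
    (* As -r M is an integer, rounding down does not go below it. *)
    rewrite floor_ge_int rmorphN/= -pmulrn natrM mulrC -mulrN.
    by rewrite ler_wpM2l// lerNl.
  rewrite -(ler_int R); apply: le_trans (floor_le _) _.
  by rewrite -pmulrn natrM mulrC ler_wpM2r.
exists z => //; rewrite mem_filter mem_undup mem_zcube// andbT.
by apply/asboolP; split=> //; exists x.
Qed.

End Limit.

Unset Implicit Arguments.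

Theorem theorem3p18 (R : realType) (d p : nat) (hp : prime p)
    (S : set 'rV[int]_d) (hS : standard R S)
    (T : nat -> set 'rV[int]_d) (hT : p_system p S T)
    (H : set 'rV[R]_d) (hH : truncating_halfspace (coneS R S) H)
    (eps : R) (heps : 0 < eps) :
  exists q0 : nat, forall q : nat, power_of p q -> (q0 <= q)%N ->
    let u := fun e : nat =>
      #|` fset_set (truncated_points p S T H q e)|%fset%:R
        / (p ^ (e * d) * q ^ d)%:R : R in
    (forall e : nat, finite_set (truncated_points p S T H q e)) /\
    cvgn u /\
    (Vol (p_body R p S T `&` H) - eps%:E <= (limn u)%:E)%E.
Proof.
have [semiS SST [convC closedC _]] := hS.
have [a [alpha [pos _ ->]]] := hH.
have [B B0 HB] := positive_on_bound convC closedC pos.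
have [W HW] := absorbing_shift_exists R semiS SST.
(* The successor makes room for the offset inside a cell, and gives K >= 1 even when [W] = 0. *)
pose K := (\sum_i absz (W 0%R i)).+1.
have WK i : `|W 0 i| < K%:Z.
  by rewrite -abszE ltz_nat ltnS (bigD1 i)//= leq_addr.
pose r := (Num.truncn (B * alpha)).+1.
have Br : B * alpha <= r%:R by rewrite ltW// truncnS_gt.
pose c : R := ((r + K.*2).*2.+1 ^ d)%:R.
(* The mesh 1 / p^m is fixed before q, fine enough for the boundary loss c / p^m to be at most
   [eps]. *)
have [m /(_ m (leqnn m)) cm] :=
  eventually_small (c := c) (prime_gt1 hp) (ler0n _ _) heps.
have M0 : 0 < (p ^ m)%:R :> R by rewrite ltr0n expn_gt0 prime_gt0.
have CHr x i : coneS R S x -> inner x a < alpha -> `|x 0 i| <= r%:R.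
  move=> Cx xa; apply: le_trans (HB _ Cx i) (le_trans _ Br).
  by rewrite ler_wpM2l// ltW.
have [F [uF [coverF FP]]] := cover_p_body hp hS hT m CHr.
(* Each cell meets some Delta_q within the halfspace; as the Delta_q increase and [F] is finite, one
   [f0] serves all cells. *)
have [f0 Hf0] : exists f0, forall f, (f0 <= f)%N -> forall z, z \in F ->
    exists x, [/\ Delta_q R S T (p ^ f) x, inner x a < alpha &
      forall i, (z 0 i)%:~R / (p ^ m)%:R <= x 0 i <= ((z 0 i)%:~R + 1) / (p ^ m)%:R].
  apply: eventually_all_seq => z /FP[_ [x [[_ [f0 ->] Dx] xa] zx]].
  by exists f0 => f ff0; exists x; split=> //; exact: le_Delta_q ff0 Dx.
exists (p ^ f0)%N => _ [f ->]; rewrite leq_exp2l ?prime_gt1// => /Hf0{}Hf0 u.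
have fp : power_of p (p ^ f) by exists f.
have finA e := (truncated_points_finite hp hS hT e HB B0 Br fp).1.
have cvgu : cvgn u.
  apply: (density_cvgn hp hS hT HW WK (r := r)) => e z zA.
  exact: (truncated_points_bounded hp hS hT HB B0 Br fp zA).
split=> //; split=> //.
have [E uE] : exists E, forall e, (E <= e)%N ->
    (size F)%:R / ((p ^ m) ^ d)%:R - c / (p ^ m)%:R <= u e.
  apply: (density_ge hp HW WK uF finA) => z zF.
  have [x [Dx xa zx]] := Hf0 z zF; split; first exact: (FP z zF).1.
    (* Each coordinate of z differs from that of p^m x by at most 1, so (z, a) exceeds p^m (x, a) by
       at most the sum of the |a_i|. *)
    have -> : lattice_embed R z = (p ^ m)%:R *: x + (lattice_embed R z - (p ^ m)%:R *: x).
      by rewrite addrC subrK.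
    rewrite innerDl innerZl ltr_leD// ?ltr_pM2l//.
    apply: inner_le_norm => i; rewrite !mxE.
    have /andP[] := zx i; rewrite ler_pdivrMr// ler_pdivlMr// => h1 h2.
    have K1 : 1 <= K%:R :> R by rewrite ler1n.
    by apply: le_trans K1; rewrite ler_norml; lra.
  exists x => // i; have /andP[h1 h2] := zx i.
  by rewrite mulrDl in h2; rewrite ler_norml; apply/andP; split; lra.
(* [Vol] unfolds to the outer measure, which the cells bound from above. *)
have volF : (Vol (p_body R p S T `&` [set v | (inner v a < alpha)%R]) <=
    ((size F)%:R / ((p ^ m) ^ d)%:R)%:E)%E.
  by apply: lebesgue_outer_le_cells; rewrite ?expn_gt0 ?prime_gt0.
rewrite leeBlDr//; apply: le_trans volF _; rewrite -EFinD lee_fin -lerBlDr.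
apply: limr_ge => //; near=> e.
apply: (@le_trans _ _ ((size F)%:R / ((p ^ m) ^ d)%:R - c / (p ^ m)%:R)).
  by rewrite lerB.
by apply: uE; near: e; exact: nbhs_infty_ge.
Unshelve. all: by end_near. Qed.
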